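(* Let $G$ be a finite group. If $S$ is a section of $G$, that is, $S\cong H/N$ for some subgroups $N\trianglelefteq H\le G$, then $\eta(S)\le\eta(G)$.
   Context: For a finite group $G$, $\omega(G)$ denotes the set of orders of elements of $G$ and $\eta(G)=|\omega(G)|$. *)

(* Defs.v *)
From mathcomp Require Import all_boot all_fingroup.

Set Implicit Arguments.
Unset Strict Implicit.
Unset Printing Implicit Defensive.

Local Open Scope group_scope.

(* A finite set of naturals, represented by a duplicate-free sequence. *)
Definition omega (gT : finGroupType) (G : {group gT}) : seq nat :=
  undup [seq #[x] | x in G].

Definition eta (gT : finGroupType) (G : {group gT}) : nat := size (omega G).

(* S is only required to be isomorphic to H / N, so it may live in a different
   ambient group type. *)
Definition is_section (sT gT : finGroupType)
    (S : {group sT}) (G : {group gT}) : Prop :=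
  exists H N : {group gT}, [/\ H \subset G, N <| H & S \isog H / N].

(* Main.v *)
Require Import Defs.
From mathcomp Require Import all_boot all_fingroup.
From mathcomp Require Import cyclic.

(** Every element order of a section [H / N] is already an element order of
    [G], so the bound on [eta] is a comparison of cardinals of nested sets.
    If a coset [xN] has order [m], then [m] divides the order of [x], since
    the quotient map can only shrink orders to divisors, and the cyclic group
    [<[x]>] contains an element of each order dividing [#[x]]; so [omega] is
    monotone under subgroups ([omegaS]) and under epimorphic images
    ([omega_morphim]).  An isomorphism is the special case of an epimorphism,
    which carries the result from [H / N] to [S]. *)

Local Open Scope group_scope.

Lemma omegaP (gT : finGroupType) (G : {group gT}) (n : nat) :
  reflect (exists2 x, x \in G & n = #[x]) (n \in omega G).
Proof. by rewrite mem_undup; apply: imageP. Qed.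

Lemma omegaS (gT : finGroupType) (H G : {group gT}) :
  H \subset G -> {subset omega H <= omega G}.
Proof.
move=> /subsetP sHG n /omegaP [x Hx ->].
by apply/omegaP; exists x; rewrite ?sHG.
Qed.

(** If [f x] has order [m], then [x] itself may have larger order, but its
    power of exponent [#[x] %/ m] has order exactly [m]. *)
Lemma omega_morphim (aT rT : finGroupType) (D G : {group aT})
    (f : {morphism D >-> rT}) :
  G \subset D -> {subset omega (f @* G)%G <= omega G}.
Proof.
move=> sGD n /omegaP [_ /morphimP [x Dx Gx ->] ->].
have dvd_fx : #[f x] %| #[x] by apply: morph_order.
apply/omegaP; exists (x ^+ (#[x] %/ #[f x])); first exact: groupX.
by rewrite orderXdiv ?dvdn_div // divnA // mulKn // order_gt0.
Qed.

Lemma omega_isog (aT rT : finGroupType) (G : {group aT}) (H : {group rT}) :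
  G \isog H -> {subset omega G <= omega H}.
Proof.
rewrite isog_sym => /isogP [f _ fHG] n Gn.
apply: (omega_morphim _ _ _ _ f (subxx H)).
by rewrite (_ : (f @* H)%G = G) //; apply/val_inj.
Qed.

Theorem corollary3p2 (gT sT : finGroupType) (G : {group gT}) (S : {group sT})
    (hS : is_section S G) : eta S <= eta G.
Proof.
case: hS => H [N [sHG /andP [_ nNH] isoS]].
apply: uniq_leq_size (undup_uniq _) _ => n /(omega_isog _ _ _ _ isoS) HNn.
apply: (omegaS _ _ _ sHG).
exact: (omega_morphim _ _ _ _ (coset_morphism N) nNH).
Qed.
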